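(* There is an absolute constant $C$ such that for all $b,c\in\mathbb{N}$ (with $b,c\ge 2$) there exist a limit computable function $B:\Sigma^*\to\Sigma^*$, a computable probability measure $p$ on $\Sigma^*$, and a string $x\in\Sigma^*$ such that, writing $\varepsilon = C\log(bc)$: $\mathbf{K}(B,p)\le\varepsilon$; $|\mathbf{d}_{Bp}(B(x))-(b+c)|\le\varepsilon$; $|\mathbf{d}_p(x)-b|\le\varepsilon$; $|\mathbf{I}(x;\mathcal{H})-c|\le\varepsilon$.
   Context: $\Sigma=\{0,1\}$, $\Sigma^*$ the finite binary strings, $\perp$ the empty string; logs base 2. $\mathbf{K}(x\mid y)$ is prefix Kolmogorov complexity relative to auxiliary input $y$ with respect to a fixed universal prefix-free machine $U_y$; $\mathbf{K}(x)=\mathbf{K}(x\mid\perp)$. $\mathcal{H}$ is the halting sequence (characteristic sequence of the domain of $U$), and $\mathbf{I}(x;\mathcal{H})=\mathbf{K}(x)-\mathbf{K}(x\mid\mathcal{H})$. A measure is $p:\Sigma^*\to\mathbb{R}_{\ge0}$ with $\sum_{x\ne\perp}p(x)=1$. The deficiency is $\mathbf{d}_p(x)=\lceil-\log p(x)\rceil-\mathbf{K}(x)$, with $\mathbf{d}_p(\perp)=0$. A function $B:\Sigma^*\to\Sigma^*$ is limit computable if some Turing machine $T$, whenever $B(x)\ne\perp$, on input $x$ eventually writes $B(x)$ on its output tape and never changes it afterward (halting or not); when $B(x)=\perp$, $T$ eventually outputs nothing or changes its output forever. The image semi-measure is $(Bp)(y)=\sum_{z:B(z)=y}p(z)$. $\mathbf{K}(B,p)$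 denotes the complexity of the pair of indices of $B$ and $p$ in fixed enumerations of limit computable functions and of semicomputable semi-measures (the minimum of $\mathbf{K}$ of a pair of indices $(n,m)$ with $B_n=B$, $p_m=p$). *)

(* Defs.v *)
From Stdlib Require Import Reals List Bool Arith ClassicalEpsilon.
From Coquelicot Require Import Coquelicot.
Import ListNotations.
Open Scope R_scope.

Definition str := list bool.

(** Bijective binary numbering of strings: [] |-> 0, 0 |-> 1, 1 |-> 2, 00 |-> 3, ... *)
Definition nat_of_str (s : str) : nat :=
  fold_left (fun n (b : bool) => (2 * n + 1 + (if b then 1 else 0))%nat) s 0%nat.

Fixpoint strings (n : nat) : list str :=
  match n with
  | O => [[]]
  | S k => map (cons false) (strings k) ++ map (cons true) (strings k)
  end.

Definition level_sum (n : nat) (f : str -> R) : R :=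
  fold_right Rplus 0 (map f (strings n)).

Definition prefix (s1 s2 : str) : Prop := exists r, s2 = s1 ++ r.

Inductive code : Type :=
  | CZero
  | CSucc
  | CProj (i : nat)
  | COrac
  | CComp (f : code) (gs : list code)
  | CRec (f g : code)
  | CMu (f : code).

Inductive eval (o : nat -> bool) : code -> list nat -> nat -> Prop :=
  | ev_zero args : eval o CZero args 0
  | ev_succ args : eval o CSucc args (S (hd 0%nat args))
  | ev_proj i args : eval o (CProj i) args (nth i args 0%nat)
  | ev_orac args : eval o COrac args (if o (hd 0%nat args) then 1%nat else 0%nat)
  | ev_comp f gs args vs v :
      evals o gs args vs -> eval o f vs v -> eval o (CComp f gs) args v
  | ev_rec0 f g args v :
      hd 0%nat args = 0%nat -> eval o f (tl args) v -> eval o (CRec f g) args v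
  | ev_recS f g args k r v :
      hd 0%nat args = S k ->
      eval o (CRec f g) (k :: tl args) r ->
      eval o g (k :: r :: tl args) v -> eval o (CRec f g) args v
  | ev_mu f args n :
      eval o f (n :: args) 0 ->
      (forall k, (k < n)%nat -> exists v, v <> 0%nat /\ eval o f (k :: args) v) ->
      eval o (CMu f) args n
with evals (o : nat -> bool) : list code -> list nat -> list nat -> Prop :=
  | evs_nil args : evals o [] args []
  | evs_cons g gs args v vs :
      eval o g args v -> evals o gs args vs -> evals o (g :: gs) args (v :: vs).

Definition no_oracle : nat -> bool := fun _ => false.

Definition run (e : code) (o : nat -> bool) (s t : str) : Prop :=
  eval o e [nat_of_str s] (nat_of_str t).

Definition prefix_free (e : code) : Prop :=
  forall o s1 s2 t1 t2, run e o s1 t1 -> run e o s2 t2 -> prefix s1 s2 -> s1 = s2.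

Definition universal_pf (U : code) : Prop :=
  prefix_free U /\
  forall e, prefix_free e ->
    exists c : nat, forall o s t, run e o s t ->
      exists q, run U o q t /\ (length q <= length s + c)%nat.

Definition Kc (U : code) (o : nat -> bool) (x : str) : nat :=
  epsilon (inhabits 0%nat)
    (fun k => (exists q, run U o q x /\ length q = k) /\
              forall q, run U o q x -> (k <= length q)%nat).

Definition K (U : code) (x : str) : nat := Kc U no_oracle x.

Definition halting (U : code) : nat -> bool :=
  fun n => if excluded_middle_informative
               (exists s t, nat_of_str s = n /\ run U no_oracle s t)
           then true else false.

Definition KH (U : code) (x : str) : nat := Kc U (halting U) x.

Definition info_halting (U : code) (x : str) : R := INR (K U x) - INR (KH U x).

Definition log2 (y : R) : R := ln y / ln 2.

(** Deficiency d_p(x) = ceil(-log p(x)) - K(x), d_p(empty) = 0,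
    taken to be +infinity when p(x) = 0.   ceil(-L) = 1 - up L. *)
Definition deficiency (U : code) (p : str -> R) (x : str) : Rbar :=
  match x with
  | [] => Finite 0
  | _ => if Rlt_dec 0 (p x)
         then Finite (IZR (1 - up (log2 (p x))) - INR (K U x))
         else p_infty
  end.

Definition measure (p : str -> R) : Prop :=
  (forall x, 0 <= p x) /\ is_series (fun n => level_sum (S n) p) 1.

Definition semimeasure (p : str -> R) : Prop :=
  (forall x, 0 <= p x) /\
  forall N, sum_n (fun n => level_sum (S n) p) N <= 1.

Definition computable_fun (p : str -> R) : Prop :=
  exists e : code, forall x n, exists m : nat,
    eval no_oracle e [nat_of_str x; n] m /\
    Rabs (INR m / 2 ^ n - p x) <= / 2 ^ n.

Definition computable_measure (p : str -> R) : Prop :=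
  measure p /\ computable_fun p.

Definition image (B : str -> str) (p : str -> R) (y : str) : R :=
  Series (fun n => level_sum n
            (fun z => if list_eq_dec bool_dec (B z) y then p z else 0)).

Definition total2 (e : code) : Prop :=
  forall (x : str) (t : nat), exists v, eval no_oracle e [nat_of_str x; t] v.

Definition lim_out (e : code) (x y : str) : Prop :=
  exists t0, forall t, (t0 <= t)%nat -> eval no_oracle e [nat_of_str x; t] (nat_of_str y).

(** B is the limit of the stage outputs of e: B(x) = y if the output stabilises
    on y, and B(x) = empty (undefined) if it never stabilises. *)
Definition limit_of (e : code) (B : str -> str) : Prop :=
  forall x, (forall y, lim_out e x y -> B x = y) /\
            ((~ exists y, lim_out e x y) -> B x = []).

Definition limit_computable (B : str -> str) : Prop :=
  exists e, total2 e /\ limit_of e B.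

(** Fixed enumeration of limit computable functions, indexed by codes:
    B_e = limit of e if e is total, constant empty function otherwise. *)
Definition lc_enum (e : code) (B : str -> str) : Prop :=
  (total2 e /\ limit_of e B) \/ (~ total2 e /\ forall x, B x = []).

Definition lsc_by (e : code) (f : str -> R) : Prop :=
  total2 e /\
  forall x, is_lub (fun r => exists t m, eval no_oracle e [nat_of_str x; t] m /\
                                         r = INR m / 2 ^ t) (f x).

(** Fixed enumeration of semicomputable semi-measures, indexed by codes:
    p_e = the function lower-semicomputed by e if it is a semi-measure,
    the zero semi-measure otherwise. *)
Definition ssm_enum (e : code) (p : str -> R) : Prop :=
  (lsc_by e p /\ semimeasure p) \/
  ((~ exists f, lsc_by e f /\ semimeasure f) /\ forall x, p x = 0).

(** Self-delimiting binary encoding of codes (used to pair indices). *)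
Fixpoint unary (n : nat) : str :=
  match n with O => [false] | S k => true :: unary k end.

Fixpoint enc (c : code) : str :=
  match c with
  | CZero => [false; false; false]
  | CSucc => [false; false; true]
  | CProj i => [false; true; false] ++ unary i
  | COrac => [false; true; true]
  | CComp f gs =>
      [true; false; false] ++ enc f ++ unary (length gs) ++
      (fix encs (l : list code) : str :=
         match l with [] => [] | g :: l' => enc g ++ encs l' end) gs
  | CRec f g => [true; false; true] ++ enc f ++ enc g
  | CMu f => [true; true; false] ++ enc f
  end.

(** K(B,p) <= r, where K(B,p) = min { K(<n,m>) : B_n = B, p_m = p }. *)
Definition KBp_le (U : code) (B : str -> str) (p : str -> R) (r : R) : Prop :=
  exists n m, lc_enum n B /\ ssm_enum m p /\ INR (K U (enc n ++ enc m)) <= r.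

(* Main.v *)
(** Let [n = b + c] and let [p] be uniform on the strings numbered [1 .. 2^n].
    Let [x] be the least nonempty string (in the numbering of strings) that is
    not the output of a program of length less than [c].  Counting programs, [x]
    is numbered at most [2^c], so [K x] is [c] up to a logarithm and [x] has
    deficiency about [n - c = b].  The halting sequence computes [x] from [c], so
    nearly all of the information in [x] is about it.  Running all programs
    shorter than [c] for longer and longer yields [x] in the limit, so the map
    [B] that sends [x] to ["0"] and fixes all other strings is limit computable.
    It moves mass [2^-n] to a string of constant complexity, whose deficiency is
    then about [n]. *)

Require Import Defs.
From Coquelicot Require Import Coquelicot.
From Stdlib Require Import Reals Bool Arith Lia Lra ClassicalEpsilon List.
Import ListNotations.
Open Scope nat_scope.

(** * Evaluation of codes *)

(** The nested [fix] supplies the induction hypothesis for the codes inside the list of a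
    [CComp]. *)
Lemma code_nested_ind (P : code -> Prop) :
  P CZero -> P CSucc -> (forall i, P (CProj i)) -> P COrac ->
  (forall f gs, P f -> Forall P gs -> P (CComp f gs)) ->
  (forall f g, P f -> P g -> P (CRec f g)) ->
  (forall f, P f -> P (CMu f)) ->
  forall e, P e.
Proof.
  intros HZ HS HP HO HC HR HM. fix IH 1. intros [| | i | | f gs | f g | f].
  - exact HZ.
  - exact HS.
  - apply HP.
  - exact HO.
  - apply HC; [apply IH|]. induction gs as [|g gs IHgs]; constructor; [apply IH|exact IHgs].
  - apply HR; apply IH.
  - apply HM; apply IH.
Qed.

Lemma eval_det o e : forall args v w, eval o e args v -> eval o e args w -> v = w.
Proof.
  induction e as [| | i | | f gs IHf IHgs | f g IHf IHg | f IHf] using code_nested_ind;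
    intros args v w Hv Hw.
  1-4: inversion Hv; inversion Hw; subst; reflexivity.
  - inversion Hv as [| | | | ? ? ? vs ? Hvs Hfv | | |]; subst.
    inversion Hw as [| | | | ? ? ? ws ? Hws Hfw | | |]; subst.
    enough (vs = ws) by (subst; eauto).
    clear Hv Hw Hfv Hfw. revert vs ws Hvs Hws.
    induction IHgs as [|g gs Hg _ IH]; intros vs ws Hvs Hws;
      inversion Hvs; inversion Hws; subst; f_equal; eauto.
  - remember (hd 0 args) as k eqn:Hk. revert args v w Hk Hv Hw.
    induction k as [|k IHk]; intros args v w Hk Hv Hw;
      inversion Hv as [| | | | | ? ? ? ? Hh1 Hf1 | ? ? ? k1 r1 ? Hh1 Hr1 Hg1 |]; subst; try congruence;
      inversion Hw as [| | | | | ? ? ? ? Hh2 Hf2 | ? ? ? k2 r2 ? Hh2 Hr2 Hg2 |]; subst; try congruence.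
    + eauto.
    + assert (k1 = k) as -> by congruence. assert (k2 = k) as -> by congruence.
      assert (r1 = r2) as -> by (eapply IHk; [|eassumption|eassumption]; reflexivity). eauto.
  - inversion Hv as [| | | | | | | ? ? ? Hv0 Hvlt]; subst.
    inversion Hw as [| | | | | | | ? ? ? Hw0 Hwlt]; subst.
    (* If one result of the search were smaller, [f] would take both the value 0 and a nonzero value
       there. *)
    destruct (lt_eq_lt_dec v w) as [[Hlt|Heq]|Hlt]; [|exact Heq|].
    + destruct (Hwlt _ Hlt) as (u & Hu & Hev). now destruct Hu; eapply IHf; eauto.
    + destruct (Hvlt _ Hlt) as (u & Hu & Hev). now destruct Hu; eapply IHf; eauto.
Qed.

Lemma eval_eq o e args v w : eval o e args v -> v = w -> eval o e args w.
Proof. now intros H <-. Qed.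

Lemma eval_rec o f g args (F : nat -> nat) :
  eval o f args (F 0) -> (forall k, eval o g (k :: F k :: args) (F (S k))) ->
  forall k, eval o (CRec f g) (k :: args) (F k).
Proof.
  intros H0 HS; induction k as [|k IH].
  - now apply ev_rec0.
  - eapply ev_recS; [reflexivity|exact IH|apply HS].
Qed.

Lemma eval_mu o f args (F : nat -> nat) n :
  (forall k, eval o f (k :: args) (F k)) -> F n = 0 -> (forall k, k < n -> F k <> 0) ->
  eval o (CMu f) args n.
Proof.
  intros HF Hn Hlt; apply ev_mu.
  - rewrite <- Hn; apply HF.
  - intros k Hk; exists (F k); auto.
Qed.

Lemma least_witness (P : nat -> Prop) : (forall k, {P k} + {~ P k}) ->
  forall m, P m -> exists n, n <= m /\ P n /\ forall k, k < n -> ~ P k.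
Proof.
  intros dec m; induction m as [m IH] using (well_founded_induction lt_wf); intros Hm.
  destruct (excluded_middle_informative (exists k, k < m /\ P k)) as [(k & Hk & Pk)|No].
  - destruct (IH k Hk Pk) as (n & Hn & H); exists n; split; [lia|exact H].
  - exists m; repeat split; auto. intros k Hk Pk; apply No; eauto.
Qed.

Create HintDb ev discriminated.

Ltac ev :=
  lazymatch goal with
  | |- evals _ [] _ _ => apply evs_nil
  | |- evals _ (_ :: _) _ _ => eapply evs_cons; [ev|ev]
  | |- eval _ (CComp _ _) _ _ => eapply ev_comp; [ev|ev]
  | |- eval _ CZero _ _ => apply ev_zero
  | |- eval _ CSucc _ _ => apply ev_succ
  | |- eval _ (CProj _) _ _ => apply ev_proj
  | |- eval _ COrac _ _ => apply ev_orac
  | |- eval _ _ _ _ => solve [eauto with ev nocore]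
  end.

(** * Arithmetic *)

Fixpoint numeral (n : nat) : code :=
  match n with O => CZero | S k => CComp CSucc [numeral k] end.

Lemma eval_numeral o n args : eval o (numeral n) args n.
Proof. induction n as [|n IH]; simpl; [constructor|]. eapply ev_comp; [constructor; [exact IH|constructor]|constructor]. Qed.
#[local] Hint Resolve eval_numeral : ev.

Definition cPred : code := CRec CZero (CProj 0).
Lemma eval_pred o x : eval o cPred [x] (pred x).
Proof. apply eval_rec with (F := pred); intros; ev. Qed.
#[local] Hint Resolve eval_pred : ev.

(** In the step code of a [CRec], positions 0 and 1 hold the counter and the previous value, so the
    parameters start at position 2. *)
Definition cGuard : code := CRec CZero (CProj 2).
Lemma eval_guard o x y : eval o cGuard [x; y] (if x =? 0 then 0 else y).
Proof. apply eval_rec with (F := fun x => if x =? 0 then 0 else y); intros; ev. Qed.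
#[local] Hint Resolve eval_guard : ev.

Definition cIf0 : code := CRec (CProj 0) (CProj 3).
Lemma eval_if0 o x y z : eval o cIf0 [x; y; z] (if x =? 0 then y else z).
Proof. apply eval_rec with (F := fun x => if x =? 0 then y else z); intros; ev. Qed.
#[local] Hint Resolve eval_if0 : ev.

Definition cAdd : code := CRec (CProj 0) (CComp CSucc [CProj 1]).
Lemma eval_add o x y : eval o cAdd [x; y] (x + y).
Proof. apply eval_rec with (F := fun x => x + y); intros; ev. Qed.
#[local] Hint Resolve eval_add : ev.

Definition cMul : code := CRec CZero (CComp cAdd [CProj 2; CProj 1]).
Lemma eval_mul o x y : eval o cMul [x; y] (x * y).
Proof. apply eval_rec with (F := fun x => x * y); intros; ev. Qed.
#[local] Hint Resolve eval_mul : ev.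

Definition cSub : code := CComp (CRec (CProj 0) (CComp cPred [CProj 1])) [CProj 1; CProj 0].
Lemma eval_sub o x y : eval o cSub [x; y] (x - y).
Proof.
  eapply ev_comp; [ev|]; simpl.
  apply eval_rec with (F := fun y => x - y); intros.
  - eapply eval_eq; [ev|simpl; lia].
  - eapply eval_eq; [ev|simpl; lia].
Qed.
#[local] Hint Resolve eval_sub : ev.

(** Subtraction is truncated, so the sum of both differences vanishes exactly for equal arguments.
    This is the equality test of the later searches. *)
Definition cDist : code := CComp cAdd [cSub; CComp cSub [CProj 1; CProj 0]].
Lemma eval_dist o x y : eval o cDist [x; y] ((x - y) + (y - x)).
Proof. unfold cDist; ev. Qed.
#[local] Hint Resolve eval_dist : ev.

Definition cPow2 : code := CRec (numeral 1) (CComp cAdd [CProj 1; CProj 1]).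
Lemma eval_pow2 o x : eval o cPow2 [x] (2 ^ x).
Proof. apply eval_rec with (F := fun x => 2 ^ x); intros; eapply eval_eq; try ev; simpl; lia. Qed.
#[local] Hint Resolve eval_pow2 : ev.

(** * Clocked simulation *)

(** [cf t args] is [0] while [e] has no value within time [t], and [v + 1] once
    it has the value [v].  The arity [n] is fixed because a code can only pass on
    boundedly many arguments to a subcode. *)
Definition clocks (n : nat) (e ce : code) (cf : nat -> list nat -> nat) : Prop :=
  (forall o t args, length args = n -> eval o ce (t :: args) (cf t args)) /\
  (forall t args v, length args = n -> cf t args = S v -> eval no_oracle e args v) /\
  (forall args v, length args = n -> eval no_oracle e args v ->
     exists t0, forall t, t0 <= t -> cf t args = S v).

(** Hands a block of arguments on to a subcode when a clock or loop variables stand in front of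
    it. *)
Lemma evals_proj o pre args post : 
  evals o (map CProj (seq (length pre) (length args))) (pre ++ args ++ post) args.
Proof.
  revert pre; induction args as [|a args IH]; intros pre; simpl; constructor.
  - eapply eval_eq; [apply ev_proj|]. rewrite app_nth2, Nat.sub_diag; auto.
  - specialize (IH (pre ++ [a])). rewrite length_app, Nat.add_1_r, <- app_assoc in IH. exact IH.
Qed.

(** [cfs] lists the clocked values and [all] is the flag that every one of them is present. The flag
    is kept apart because [pred] cannot tell a missing value from the value 0. *)
Lemma clocks_list n gs :
  Forall (fun e => forall n, exists ce cf, clocks n e ce cf) gs ->
  exists ces call (cfs : nat -> list nat -> list nat) (all : nat -> list nat -> nat),
    length ces = length gs /\
    (forall o t args, length args = n -> evals o ces (t :: args) (cfs t args)) /\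
    (forall t args, length (cfs t args) = length gs) /\
    (forall o t args, length args = n -> eval o call (t :: args) (all t args)) /\
    (forall t args, length args = n -> all t args <> 0 ->
       evals no_oracle gs args (map pred (cfs t args))) /\
    (forall args vs, length args = n -> evals no_oracle gs args vs ->
       exists t0, forall t, t0 <= t -> all t args <> 0 /\ map pred (cfs t args) = vs).
Proof.
  induction 1 as [|g gs Hg _ IH].
  - exists [], (numeral 1), (fun _ _ => []), (fun _ _ => 1).
    split; [reflexivity|]. split; [intros; constructor|]. split; [reflexivity|].
    split; [intros; ev|]. split; [intros; constructor|].
    intros args vs _ H; inversion H; subst. exists 0; intros; split; [lia|reflexivity].
  - destruct (Hg n) as (cg & gf & Gev & Gs & Gc).
    destruct IH as (ces & call & cfs & all & L1 & E1 & L2 & E2 & Hs & Hc).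
    exists (cg :: ces), (CComp cGuard [cg; call]),
      (fun t args => gf t args :: cfs t args), (fun t args => if gf t args =? 0 then 0 else all t args).
    repeat split; simpl.
    + now rewrite L1.
    + intros; constructor; auto.
    + intros; now rewrite L2.
    + intros; eapply ev_comp; [|apply eval_guard]. repeat (constructor; auto).
    + intros t args Hl Ha. destruct (gf t args) as [|v] eqn:Ev; [easy|]. constructor; simpl in *; eauto.
    + intros args vs Hl Hvs; inversion Hvs as [|? ? ? v vs' Hv Hvs']; subst.
      destruct (Gc _ _ eq_refl Hv) as (t1 & H1). destruct (Hc _ _ eq_refl Hvs') as (t2 & H2).
      exists (t1 + t2); intros t Ht. rewrite H1 by lia. destruct (H2 t) as (H3 & H4); [lia|].
      simpl; split; [exact H3|now rewrite H4].
Qed.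

Lemma evals_map_comp1 o f F gs args vs :
  (forall x, eval o f [x] (F x)) -> evals o gs args vs ->
  evals o (map (fun g => CComp f [g]) gs) args (map F vs).
Proof.
  intros Hf; revert vs; induction gs as [|g gs IH]; intros vs H; inversion H; subst; simpl; constructor; auto.
  eapply ev_comp; [constructor; [eassumption|constructor]|apply Hf].
Qed.

(** [f] is simulated on the decoded values, and the guard discards the result until all of them are
    genuine. *)
Lemma clocks_comp f gs n :
  (forall n, exists ce cf, clocks n f ce cf) ->
  Forall (fun e => forall n, exists ce cf, clocks n e ce cf) gs ->
  exists ce cf, clocks n (CComp f gs) ce cf.
Proof.
  intros Hf Hgs. destruct (Hf (length gs)) as (cef & cff & Fe & Fs & Fc).
  destruct (clocks_list n gs Hgs) as (ces & call & cfs & all & L1 & E1 & L2 & E2 & Hs & Hc).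
  exists (CComp cGuard [call; CComp cef (CProj 0 :: map (fun g => CComp cPred [g]) ces)]),
    (fun t args => if all t args =? 0 then 0 else cff t (map pred (cfs t args))).
  repeat split.
  - intros o t args Hl. eapply ev_comp; [|apply eval_guard].
    constructor; [auto|]. constructor; [|constructor].
    eapply ev_comp.
    + constructor; [apply ev_proj|]. apply evals_map_comp1 with (F := pred); [intros; ev|auto].
    + simpl. apply Fe. now rewrite length_map.
  - intros t args v Hl. destruct (all t args) as [|a] eqn:Ea; simpl; [discriminate|].
    intros Hv. eapply ev_comp; [apply Hs; [exact Hl|now rewrite Ea]|].
    eapply Fs; [now rewrite length_map|exact Hv].
  - intros args v Hl He; inversion He as [| | | | ? ? ? vs ? Hvs Hfv | | |]; subst.
    destruct (Hc _ _ eq_refl Hvs) as (t1 & H1).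
    assert (Lvs : length vs = length gs) by (destruct (H1 t1) as (_ & <-); [lia|now rewrite length_map]).
    destruct (Fc _ _ Lvs Hfv) as (t2 & H2).
    exists (t1 + t2); intros t Ht. destruct (H1 t) as (Ha & ->); [lia|].
    destruct (Nat.eqb_spec (all t args) 0); [easy|]. apply H2; lia.
Qed.

Lemma clocks_rec f g n :
  (forall n, exists ce cf, clocks n f ce cf) ->
  (forall n, exists ce cf, clocks n g ce cf) ->
  exists ce cf, clocks n (CRec f g) ce cf.
Proof.
  intros Hf Hg. destruct n as [|n].
  (* Without arguments the recursion argument defaults to 0, so only the base case arises. *)
  - destruct (Hf 0) as (cef & cff & Fe & Fs & Fc). exists cef, cff. repeat split; auto.
    + intros t [|] v Hl H; [|discriminate]. apply ev_rec0; [reflexivity|]. eapply Fs; eauto.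
    + intros [|] v Hl H; [|discriminate]. inversion H; [|discriminate]; subst. now apply Fc.
  - destruct (Hf n) as (cef & cff & Fe & Fs & Fc).
    destruct (Hg (S (S n))) as (ceg & cgf & Ge & Gs & Gc).
    pose (R := fix R t rest a := match a with
       | 0 => cff t rest
       | S k => if R t rest k =? 0 then 0 else cgf t (k :: pred (R t rest k) :: rest) end).
    (* [CRec] recurses on its first argument, so the clock is first moved behind the recursion
       argument. *)
    exists (CComp (CRec cef (CComp cGuard [CProj 1;
              CComp ceg (CProj 2 :: CProj 0 :: CComp cPred [CProj 1] :: map CProj (seq 3 n))]))
            (CProj 1 :: CProj 0 :: map CProj (seq 2 n))),
      (fun t args => R t (tl args) (hd 0 args)).
    repeat split.
    + intros o t [|a rest] Hl; [discriminate|]. injection Hl as Hl. subst n. simpl hd; simpl tl.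
      eapply ev_comp with (vs := a :: t :: rest).
      * constructor; [apply ev_proj|]. constructor; [apply ev_proj|].
        generalize (evals_proj o [t; a] rest []). now rewrite app_nil_r.
      * apply eval_rec with (F := R t rest); [now apply Fe|].
        intros k. eapply ev_comp; [|apply eval_guard].
        constructor; [apply ev_proj|]. constructor; [|constructor].
        eapply ev_comp with (vs := t :: k :: pred (R t rest k) :: rest);
          [|apply Ge; simpl; lia].
        constructor; [apply ev_proj|]. constructor; [apply ev_proj|].
        constructor; [ev|].
        generalize (evals_proj o [k; R t rest k; t] rest []). now rewrite app_nil_r.
    + intros t [|a rest] v Hl; [discriminate|]. injection Hl as Hl. simpl hd; simpl tl.
      revert v; induction a as [|a IH]; intros v Hv; simpl in Hv.
      * apply ev_rec0; [reflexivity|]. eapply Fs; eauto.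
      * destruct (R t rest a) as [|r]; simpl in Hv; [discriminate|].
        eapply ev_recS; [reflexivity|now apply IH|]. eapply Gs; [|exact Hv]. simpl; lia.
    + intros [|a rest] v Hl; [discriminate|]. injection Hl as Hl. simpl hd; simpl tl.
      revert v; induction a as [|a IH]; intros v Hv;
        inversion Hv as [| | | | | ? ? ? ? Hh Hf1 | ? ? ? k r ? Hh Hr Hg1 |]; subst; try discriminate.
      * destruct (Fc rest v eq_refl Hf1) as (t0 & H0). exists t0; exact H0.
      * injection Hh as ->. destruct (IH _ Hr) as (t1 & H1).
        destruct (Gc (k :: r :: rest) v eq_refl Hg1) as (t2 & H2).
        exists (t1 + t2); intros t Ht; simpl. rewrite H1 by lia. apply H2; lia.
Qed.

(** The search state is [0] while running, [1] once an argument is not yet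
    evaluated, and [k + 2] once the zero [k] is found. *)
Lemma clocks_mu f n :
  (forall n, exists ce cf, clocks n f ce cf) -> exists ce cf, clocks n (CMu f) ce cf.
Proof.
  intros Hf. destruct (Hf (S n)) as (cef & cff & Fe & Fs & Fc).
  pose (st := fun t args j s => if s =? 0 then
      (let r := cff t (j :: args) in
       if r =? 0 then 1 else if pred r =? 0 then S (S j) else 0) else s).
  pose (R := fix R t args j := match j with 0 => 0 | S k => st t args k (R t args k) end).
  set (cr := CComp cef (CProj 2 :: CProj 0 :: map CProj (seq 3 n))).
  exists (CComp cPred [CComp (CRec CZero
      (CComp cIf0 [CProj 1;
         CComp cIf0 [cr; numeral 1; CComp cIf0 [CComp cPred [cr]; CComp CSucc [CComp CSucc [CProj 0]]; CZero]];
         CProj 1])) (CProj 0 :: CProj 0 :: map CProj (seq 1 n))]),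
    (* The clock also bounds the number of search steps. [pred] turns the states 0 and 1 into no
       value, and [k + 2] into the clocked form of [k]. *)
    (fun t args => pred (R t args t)).
  (* Search invariant: every point passed over has a known nonzero value, whence a zero that is
     found is the least one. *)
  assert (HR : forall t args j,
    match R t args j with
    | 0 => forall k, k < j -> exists r, cff t (k :: args) = S (S r)
    | 1 => exists k, cff t (k :: args) = 0 /\
                     forall i, i < k -> exists r, cff t (i :: args) = S (S r)
    | S (S k) => k < j /\ cff t (k :: args) = 1 /\
                 forall i, i < k -> exists r, cff t (i :: args) = S (S r)
    end).
  { intros t args j; induction j as [|j IH]; [simpl; intros; lia|].
    change (R t args (S j)) with (st t args j (R t args j)).
    destruct (R t args j) as [|[|k]]; unfold st; simpl.
    - destruct (cff t (j :: args)) as [|[|r]] eqn:Er; simpl.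
      + exists j; split; [exact Er|exact IH].
      + repeat split; auto.
      + intros k Hk. destruct (Nat.eq_dec k j) as [->|]; [eauto|apply IH; lia].
    - exact IH.
    - destruct IH as (Hk & H); split; [lia|exact H]. }
  repeat split.
  - intros o t args Hl; subst n. eapply ev_comp; [|apply eval_pred]. constructor; [|constructor].
    eapply ev_comp with (vs := t :: t :: args).
    + constructor; [apply ev_proj|]. constructor; [apply ev_proj|].
      generalize (evals_proj o [t] args []). now rewrite app_nil_r.
    + apply eval_rec with (F := R t args); [constructor|]. intros k.
      assert (Hcr : eval o cr (k :: R t args k :: t :: args) (cff t (k :: args))).
      { eapply ev_comp with (vs := t :: k :: args); [|now apply Fe; simpl].
        constructor; [apply ev_proj|]. constructor; [apply ev_proj|].
        generalize (evals_proj o [k; R t args k; t] args []). now rewrite app_nil_r. }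
      clearbody cr.
      eapply eval_eq.
      * repeat (lazymatch goal with |- eval _ cr _ _ => exact Hcr | |- eval _ (CComp _ _) _ _ => eapply ev_comp
         | |- evals _ [] _ _ => apply evs_nil
         | |- evals _ (_ :: _) _ _ => eapply evs_cons | _ => ev end).
      * reflexivity.
  - intros t args v Hl Hv. specialize (HR t args t).
    destruct (R t args t) as [|[|k]]; simpl in Hv; try discriminate. injection Hv as ->.
    destruct HR as (Hk & H1 & H2). apply ev_mu.
    + eapply Fs; [|exact H1]. simpl; lia.
    + intros k Hlt. destruct (H2 k Hlt) as (r & Hr). exists (S r). split; [lia|].
      eapply Fs; [|exact Hr]. simpl; lia.
  - intros args v Hl H. inversion H as [| | | | | | | ? ? ? H0 Hlt]; subst.
    (* Only finitely many points lie below [v], so one time serves them all. *)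
    assert (Hlt' : exists t0, forall t k, t0 <= t -> k < v -> exists r, cff t (k :: args) = S (S r)).
    { clear H H0. induction v as [|v IH].
      - exists 0; intros; lia.
      - destruct IH as (t1 & H1); [intros; apply Hlt; lia|].
        destruct (Hlt v) as (u & Hu & He); [lia|].
        destruct (Fc (v :: args) u eq_refl He) as (t2 & H2).
        exists (t1 + t2); intros t k Ht Hk. destruct (Nat.eq_dec k v) as [->|].
        + exists (pred u). rewrite H2 by lia. lia.
        + apply H1; lia. }
    destruct Hlt' as (t1 & H1). destruct (Fc (v :: args) 0 eq_refl H0) as (t2 & H2).
    (* The summand [v] and the successor let the search run long enough to examine [v] itself. *)
    exists (S (t1 + t2 + v)); intros t Ht. specialize (HR t args t).
    specialize (H2 t ltac:(lia)). specialize (fun k => H1 t k ltac:(lia)).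
    destruct (R t args t) as [|[|k]]; simpl.
    + destruct (HR v) as (r & Hr); [lia|congruence].
    + destruct HR as (k & Hr & Hi). destruct (lt_eq_lt_dec k v) as [[Hkv| ->]|Hkv].
      * destruct (H1 k Hkv); congruence.
      * congruence.
      * destruct (Hi v Hkv); congruence.
    + destruct HR as (Hk & Hr & Hi). destruct (lt_eq_lt_dec k v) as [[Hkv| ->]|Hkv]; [|reflexivity|].
      * destruct (H1 k Hkv); congruence.
      * destruct (Hi v Hkv); congruence.
Qed.
(** The simulator is built for each code separately, by recursion on its structure, in place of a
    universal interpreter with a step count. *)
Lemma clocks_exist e : forall n, exists ce cf, clocks n e ce cf.
Proof.
  induction e as [| | i | | f gs IHf IHgs | f g IHf IHg | f IHf] using code_nested_ind; intros n.
  - exists (numeral 1), (fun _ _ => 1). repeat split; intros; [ev| |exists 0; intros].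
    + injection H0 as <-. constructor.
    + now inversion H0.
  - exists (CComp CSucc [CComp CSucc [CProj 1]]), (fun _ args => S (S (hd 0 args))).
    repeat split; intros; [|injection H0 as <-; constructor|exists 0; intros; now inversion H0].
    eapply eval_eq; [ev|]. now destruct args.
  - exists (CComp CSucc [CProj (S i)]), (fun _ args => S (nth i args 0)).
    repeat split; intros; [ev|injection H0 as <-; constructor|exists 0; intros; now inversion H0].
  (* Under [no_oracle] every query is answered by 0, whose clocked form is 1. *)
  - exists (numeral 1), (fun _ _ => 1).
    repeat split; intros; [ev|injection H0 as <-; apply (ev_orac no_oracle)|exists 0; intros; now inversion H0].
  - now apply clocks_comp.
  - now apply clocks_rec.
  - now apply clocks_mu.
Qed.

(** * Numbering of strings *)

(** The fold of [nat_of_str] from an arbitrary start, so that concatenation of strings becomes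
    composition. *)
Definition app_bits (s : str) (a : nat) : nat :=
  fold_left (fun n (b : bool) => 2 * n + 1 + (if b then 1 else 0)) s a.

Lemma app_bits_app s1 s2 a : app_bits (s1 ++ s2) a = app_bits s2 (app_bits s1 a).
Proof. apply fold_left_app. Qed.

Lemma nat_of_str_app s1 s2 : nat_of_str (s1 ++ s2) = app_bits s2 (nat_of_str s1).
Proof. apply fold_left_app. Qed.

Lemma app_bits_shift s a : app_bits s a = a * 2 ^ length s + nat_of_str s.
Proof.
  change (nat_of_str s) with (app_bits s 0).
  induction s as [|b s IH] using rev_ind; [simpl; lia|].
  rewrite !app_bits_app, length_app, Nat.add_1_r, IH; simpl; destruct b; lia.
Qed.

Lemma nat_of_str_bounds s :
  2 ^ length s <= S (nat_of_str s) /\ S (nat_of_str s) < 2 ^ S (length s).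
Proof.
  induction s as [|b s IH] using rev_ind; [cbn; lia|].
  rewrite nat_of_str_app, length_app, Nat.add_1_r; cbn [app_bits fold_left]; rewrite !Nat.pow_succ_r' in *; unfold app_bits; cbn [fold_left]; destruct b; lia.
Qed.

Lemma nat_of_str_inj s1 : forall s2, nat_of_str s1 = nat_of_str s2 -> s1 = s2.
Proof.
  induction s1 as [|b1 s1 IH] using rev_ind; intros s2;
    destruct s2 as [|b2 s2 _] using rev_ind; rewrite ?nat_of_str_app; unfold app_bits; cbn [fold_left]; intros H.
  - reflexivity.
  - cbn in H; destruct b2; lia.
  - cbn in H; destruct b1; lia.
  - assert (b1 = b2) as -> by (destruct b1, b2; auto; lia). f_equal. apply IH; lia.
Qed.

Lemma nat_of_str_surj n : exists s, nat_of_str s = n.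
Proof.
  induction n as [n IH] using (well_founded_induction lt_wf).
  destruct n as [|n]; [now exists []|].
  destruct (Nat.Even_or_Odd n) as [[m Hm]|[m Hm]]; destruct (IH m ltac:(lia)) as (s & Hs).
  - exists (s ++ [false]). rewrite nat_of_str_app, Hs; cbn; lia.
  - exists (s ++ [true]). rewrite nat_of_str_app, Hs; cbn; lia.
Qed.

Definition str_of_nat (n : nat) : str := epsilon (inhabits []) (fun s => nat_of_str s = n).

Lemma str_of_natK n : nat_of_str (str_of_nat n) = n.
Proof. exact (epsilon_spec (inhabits []) _ (nat_of_str_surj n)). Qed.

Definition blen (n : nat) : nat := length (str_of_nat n).

Lemma blen_le n L : S n < 2 ^ S L -> blen n <= L.
Proof.
  intros H. destruct (nat_of_str_bounds (str_of_nat n)) as [Hl _]. rewrite str_of_natK in Hl.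
  assert (blen n < S L) by (apply (Nat.pow_lt_mono_r_iff 2); unfold blen; lia). lia.
Qed.

Lemma blen_log2 n : blen n <= Nat.log2 (S n).
Proof. apply blen_le, Nat.log2_spec; lia. Qed.

Definition cLen : code :=
  CMu (CComp cSub [CComp CSucc [CComp CSucc [CProj 1]]; CComp cPow2 [CComp CSucc [CProj 0]]]).
Lemma eval_len o n : eval o cLen [n] (blen n).
Proof.
  apply eval_mu with (F := fun L => S (S n) - 2 ^ S L); [intros; ev| |].
  - destruct (nat_of_str_bounds (str_of_nat n)) as [_ Hu]. rewrite str_of_natK in Hu.
    change (length _) with (blen n) in Hu. lia.
  - intros k Hk H. apply Nat.lt_nge in Hk; apply Hk, blen_le. lia.
Qed.
#[local] Hint Resolve eval_len : ev.

(** * Prefix-free codewords and machines *)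

Definition codewords (d : nat -> str) (cd : code) : Prop :=
  (forall i j, prefix (d i) (d j) -> i = j) /\
  forall o n, eval o cd [n] (nat_of_str (d n)).

Lemma prefix_app_inv (s1 s2 r1 r2 : str) :
  prefix (s1 ++ r1) (s2 ++ r2) -> prefix s1 s2 \/ prefix s2 s1.
Proof.
  intros [r Hr]. rewrite <- app_assoc in Hr. revert s2 Hr; induction s1 as [|a s1 IH]; intros s2 Hr.
  - left; now exists s2.
  - destruct s2 as [|b s2]; [right; now exists (a :: s1)|].
    injection Hr as -> Hr. destruct (IH _ Hr) as [[q ->]|[q ->]]; [left|right]; now exists q.
Qed.

Lemma prefix_app_cancel (s r1 r2 : str) : prefix (s ++ r1) (s ++ r2) -> prefix r1 r2.
Proof.
  intros [r Hr]. rewrite <- app_assoc in Hr. apply app_inv_head in Hr. now exists r.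
Qed.

Lemma unary_prefix : forall i j, prefix (unary i) (unary j) -> i = j.
Proof.
  induction i as [|i IH]; intros [|j] [r Hr]; simpl in Hr; try discriminate; auto.
  injection Hr as Hr. f_equal. apply IH. now exists r.
Qed.

(** The number of [unary n] is [2 ^ (n + 2) - 3]. *)
Definition cUnary : code := CComp cSub [CComp cPow2 [CComp CSucc [CComp CSucc [CProj 0]]]; numeral 3].
Lemma codewords_unary : codewords unary cUnary.
Proof.
  split; [exact unary_prefix|]. intros o n. eapply eval_eq; [unfold cUnary; ev|]. cbn [nth hd].
  enough (H : forall a, app_bits (unary n) a = (a + 2) * 2 ^ S n - 3).
  { change (nat_of_str (unary n)) with (app_bits (unary n) 0). rewrite H. simpl; lia. }
  induction n as [|n IH]; intros a; [simpl; lia|].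
  change (app_bits (unary (S n)) a) with (app_bits (unary n) (2 * a + 1 + 1)).
  rewrite IH, (Nat.pow_succ_r' 2 (S n)). f_equal. lia.
Qed.

(** Prefixing the length costs only [length (d (blen n))] bits: from [unary] it
    gives a code of length about [2 log n], and from that one a code of length
    about [log n + 2 log log n]. *)
Definition self_delim (d : nat -> str) (n : nat) : str := d (blen n) ++ str_of_nat n.

Definition cSelf (cd : code) : code :=
  CComp cAdd [CComp cMul [CComp cd [cLen]; CComp cPow2 [cLen]]; CProj 0].

(** If one codeword is a prefix of another, their length headers are comparable and hence equal. The
    remaining parts then have the same length, and a prefix of equal length is the whole string. *)
Lemma codewords_self_delim d cd : codewords d cd -> codewords (self_delim d) (cSelf cd).
Proof.
  intros [Hp Hc]; split.
  - unfold self_delim; intros i j H.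
    assert (Hij : blen i = blen j).
    { destruct (prefix_app_inv _ _ _ _ H) as [H'|H']; apply Hp in H'; auto. }
    rewrite Hij in H. apply prefix_app_cancel in H. destruct H as [r Hr].
    assert (r = []) as ->.
    { apply (f_equal (@length bool)) in Hr. unfold blen in Hij. rewrite length_app in Hr.
      apply length_zero_iff_nil; lia. }
    rewrite app_nil_r in Hr. rewrite <- (str_of_natK i), <- (str_of_natK j); now f_equal.
  - intros o n. unfold self_delim, cSelf. rewrite nat_of_str_app, app_bits_shift, str_of_natK.
    pose proof (Hc o) as Hco.
    eapply eval_eq; [eapply ev_comp; [|ev]; constructor; [|ev]; eapply ev_comp; [|ev];
      constructor; [eapply ev_comp; [ev|apply Hc]|ev]|reflexivity].
Qed.

(** Inverts [cd] by unbounded search, so that no program need be parsed and the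
    domain consists of codewords under every oracle. *)
Definition cMachine (cd g : code) : code :=
  CComp g [CMu (CComp cDist [CComp cd [CProj 0]; CProj 1])].

Lemma machine_run d cd g o n y : codewords d cd ->
  eval o g [n] (nat_of_str y) -> run (cMachine cd g) o (d n) y.
Proof.
  intros [Hp Hc] Hg. eapply ev_comp; [|exact Hg]. constructor; [|constructor].
  apply eval_mu with (F := fun k => (nat_of_str (d k) - nat_of_str (d n)) + (nat_of_str (d n) - nat_of_str (d k))).
  - intros k. eapply ev_comp; [|ev]. constructor; [eapply ev_comp; [ev|apply Hc]|ev].
  - lia.
  - intros k Hk H. enough (k = n) by lia. apply Hp. rewrite (nat_of_str_inj (d k) (d n)) by lia.
    exists []; now rewrite app_nil_r.
Qed.

Lemma machine_prefix_free d cd g : codewords d cd -> prefix_free (cMachine cd g).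
Proof.
  intros [Hp Hc].
  assert (Hdom : forall o s t, run (cMachine cd g) o s t -> exists n, s = d n).
  { intros o s t H. inversion H as [| | | | ? ? ? vs ? Hvs _ | | |]; subst.
    inversion Hvs as [|? ? ? n ? Hn _]; subst.
    inversion Hn as [| | | | | | | ? ? ? H0 _]; subst.
    exists n. apply nat_of_str_inj.
    assert (He : eval o (CComp cDist [CComp cd [CProj 0]; CProj 1]) [n; nat_of_str s]
      ((nat_of_str (d n) - nat_of_str s) + (nat_of_str s - nat_of_str (d n)))).
    { eapply ev_comp; [|ev]. constructor; [eapply ev_comp; [ev|apply Hc]|ev]. }
    pose proof (eval_det _ _ _ _ _ H0 He). lia. }
  intros o s1 s2 t1 t2 H1 H2 H.
  destruct (Hdom _ _ _ H1) as (n1 & ->). destruct (Hdom _ _ _ H2) as (n2 & ->).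
  now rewrite (Hp _ _ H).
Qed.

(** * Complexity bounds obtained from machines *)

Lemma Kc_spec U o q x : run U o q x ->
  (exists q', run U o q' x /\ length q' = Kc U o x) /\ Kc U o x <= length q.
Proof.
  intros H. unfold Kc. match goal with |- context [epsilon ?i ?P] =>
    assert (HP : P (epsilon i P)) end.
  (* The given run makes the set of program lengths nonempty, so the minimum that [Kc] chooses
     exists. *)
  { apply epsilon_spec.
    destruct (least_witness (fun k => exists q, run U o q x /\ length q = k)
      (fun k => excluded_middle_informative _) (length q)) as (k & _ & Hk & Hlt); [eauto|].
    exists k; split; [exact Hk|]. intros q' Hq'. destruct (le_lt_dec k (length q')); [easy|].
    destruct (Hlt (length q')); eauto. }
  destruct HP as [HP1 HP2]; eauto.
Qed.

(** The source of all upper bounds on complexity below. The constant depends only on the machine and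
    is uniform in the oracle, the number and the string. *)
Lemma Kc_machine U d cd g : universal_pf U -> codewords d cd ->
  exists k, forall o n y, eval o g [n] (nat_of_str y) ->
    (exists q, run U o q y) /\ Kc U o y <= length (d n) + k.
Proof.
  intros [_ HU] Hd. destruct (HU _ (machine_prefix_free _ _ g Hd)) as (k & Hk).
  exists k; intros o n y Hy. destruct (Hk _ _ _ (machine_run _ _ _ _ _ _ Hd Hy)) as (q & Hq & Hl).
  split; [eauto|]. destruct (Kc_spec _ _ _ _ Hq). lia.
Qed.

(** * The least string without short programs *)

(** The candidate [w] stands for the positive output [w + 1], which excludes the empty string; its
    clocked form is [w + 2]. *)
Fixpoint hits (h : nat -> nat) (w m : nat) : nat :=
  match m with
  | 0 => 0
  | S k => if h k - S (S w) + (S (S w) - h k) =? 0 then 1 else hits h w k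
  end.

Lemma hits_zero h w m : hits h w m = 0 <-> forall k, k < m -> h k <> S (S w).
Proof.
  induction m as [|m IH]; cbn [hits]; [split; [intros; lia|reflexivity]|].
  destruct (Nat.eqb_spec (h m - S (S w) + (S (S w) - h m)) 0) as [E|E].
  - split; [intros Habs; discriminate Habs|]. intros H. specialize (H m ltac:(lia)). lia.
  - rewrite IH. split; intros H k Hk; [|apply H; lia].
    destruct (Nat.eq_dec k m) as [->|]; [lia|apply H; lia].
Qed.

(** Pigeonhole: [m] programs cannot produce [m + 1] different candidates. *)
Lemma unhit_exists h m : exists w, w <= m /\ hits h w m = 0.
Proof.
  destruct (excluded_middle_informative (exists w, w <= m /\ hits h w m = 0)) as [H|H]; [exact H|].
  exfalso.
  assert (Hin : incl (map (fun w => S (S w)) (seq 0 (S m))) (map h (seq 0 m))).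
  { intros y Hy. apply in_map_iff in Hy. destruct Hy as (w & <- & Hw). apply in_seq in Hw.
    destruct (excluded_middle_informative (In (S (S w)) (map h (seq 0 m)))) as [|N]; [easy|].
    destruct H. exists w. split; [lia|]. apply hits_zero. intros k Hk E. apply N.
    apply in_map_iff. exists k. split; [exact E|apply in_seq; lia]. }
  apply NoDup_incl_length in Hin; [rewrite !length_map, !length_seq in Hin; lia|].
  apply NoDup_map_NoDup_ForallPairs; [intros i j _ _; lia|apply seq_NoDup].
Qed.

Definition unhit (h : nat -> nat) (m : nat) : nat :=
  epsilon (inhabits 0) (fun w => w <= m /\ hits h w m = 0 /\ forall k, k < w -> hits h k m <> 0).

Lemma unhit_spec h m :
  unhit h m <= m /\ hits h (unhit h m) m = 0 /\ forall k, k < unhit h m -> hits h k m <> 0.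
Proof.
  unfold unhit; apply epsilon_spec. destruct (unhit_exists h m) as (w & Hw & H0).
  destruct (least_witness (fun w => hits h w m = 0) (fun w => Nat.eq_dec _ _) w H0) as (n & Hn & H).
  exists n; split; [lia|exact H].
Qed.

Lemma unhit_ext h1 h2 m : (forall k, k < m -> h1 k = h2 k) -> unhit h1 m = unhit h2 m.
Proof.
  intros H. assert (He : forall w, hits h1 w m = hits h2 w m).
  { intros w; induction m as [|m IH]; [reflexivity|]. simpl. rewrite H, IH; auto. }
  destruct (unhit_spec h1 m) as (_ & Z1 & L1). destruct (unhit_spec h2 m) as (_ & Z2 & L2).
  destruct (lt_eq_lt_dec (unhit h1 m) (unhit h2 m)) as [[Hl|E]|Hl]; [|exact E|].
  - destruct (L2 _ Hl). now rewrite <- He.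
  - destruct (L1 _ Hl). now rewrite He.
Qed.

(** Signals that some program declared halting by the oracle has no value yet; once it vanishes, the
    stage is final for the first [m] programs. *)
Fixpoint pending (o : nat -> bool) (h : nat -> nat) (m : nat) : nat :=
  match m with
  | 0 => 0
  | S k => if (if o k then 1 else 0) =? 0 then pending o h k
           else if h k =? 0 then 1 else pending o h k
  end.

Lemma pending_zero o h m : pending o h m = 0 <-> forall k, k < m -> o k = true -> h k <> 0.
Proof.
  induction m as [|m IH]; simpl; [split; [intros; lia|reflexivity]|].
  assert (Hstep : (forall k, k < S m -> o k = true -> h k <> 0) <->
                  (o m = true -> h m <> 0) /\ (forall k, k < m -> o k = true -> h k <> 0)).
  { split; [intros H; split; intros; apply H; auto|].
    intros [Hm H] k Hk. destruct (Nat.eq_dec k m) as [->|]; [exact Hm|apply H; lia]. }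
  rewrite Hstep, <- IH. destruct (o m); simpl.
  - destruct (Nat.eqb_spec (h m) 0); intuition (auto; discriminate).
  - intuition (auto; discriminate).
Qed.

(** The strings shorter than [c] are exactly those numbered below [2 ^ c - 1]. *)
Definition cPrograms : code := CComp cPred [cPow2].

Lemma eval_programs o c : eval o cPrograms [c] (pred (2 ^ c)).
Proof. unfold cPrograms; ev. Qed.
#[local] Hint Resolve eval_programs : ev.

Definition cHits (cu : code) : code :=
  CRec CZero (CComp cIf0 [CComp cDist [CComp cu [CProj 3; CProj 0]; CComp CSucc [CComp CSucc [CProj 2]]];
                          numeral 1; CProj 1]).
Definition cStage (cu : code) : code :=
  CComp CSucc [CMu (CComp (cHits cu) [CComp cPrograms [CProj 1]; CProj 0; CProj 2])].
Definition cPending (cu : code) : code :=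
  CRec CZero (CComp cIf0 [CComp COrac [CProj 0]; CProj 1;
    CComp cIf0 [CComp cu [CProj 2; CProj 0]; numeral 1; CProj 1]]).
Definition cOracleStage (cu : code) : code :=
  CComp (cStage cu) [CProj 0; CMu (CComp (cPending cu) [CComp cPrograms [CProj 1]; CProj 0])].

Lemma eval_stage cu cf o c t : (forall o t k, eval o cu [t; k] (cf t [k])) ->
  eval o (cStage cu) [c; t] (S (unhit (fun k => cf t [k]) (pred (2 ^ c)))).
Proof.
  intros Hcu. pose proof (Hcu o) as Hcuo.
  assert (Hh : forall w m, eval o (cHits cu) [m; w; t] (hits (fun k => cf t [k]) w m)).
  { intros w m. apply eval_rec with (F := hits (fun k => cf t [k]) w); [ev|].
    intros k. eapply eval_eq; [ev|reflexivity]. }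
  eapply ev_comp; [|apply (ev_succ o [_])]. constructor; [|constructor].
  apply eval_mu with (F := fun w => hits (fun k => cf t [k]) w (pred (2 ^ c))); [|apply unhit_spec..].
  intros w; ev.
Qed.

Lemma eval_oracle_stage cu cf o c t : (forall o t k, eval o cu [t; k] (cf t [k])) ->
  pending o (fun k => cf t [k]) (pred (2 ^ c)) = 0 ->
  (forall s, s < t -> pending o (fun k => cf s [k]) (pred (2 ^ c)) <> 0) ->
  eval o (cOracleStage cu) [c] (S (unhit (fun k => cf t [k]) (pred (2 ^ c)))).
Proof.
  intros Hcu H0 Hlt. pose proof (Hcu o) as Hcuo.
  assert (Hp : forall s m, eval o (cPending cu) [m; s] (pending o (fun k => cf s [k]) m)).
  { intros s m. apply eval_rec with (F := pending o (fun k => cf s [k])); [ev|].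
    intros k. eapply eval_eq; [ev|reflexivity]. }
  eapply ev_comp; [|now apply eval_stage]. constructor; [ev|]. constructor; [|constructor].
  apply eval_mu with (F := fun s => pending o (fun k => cf s [k]) (pred (2 ^ c))); auto.
  intros s; ev.
Qed.

Lemma halting_true U k : halting U k = true <-> exists v, eval no_oracle U [k] v.
Proof.
  unfold halting. destruct (excluded_middle_informative _) as [(s & t & <- & H)|N].
  - split; [intros _; eexists; exact H|reflexivity].
  - split; [intros; discriminate|]. intros (v & Hv). destruct N.
    exists (str_of_nat k), (str_of_nat v). split; [apply str_of_natK|].
    unfold run. now rewrite !str_of_natK.
Qed.

(** [x] is the least positive number that [U] outputs on no program shorter
    than [c]: it is approximated in the limit by [cx], and computed exactly by
    [ch] from the halting sequence, which tells when all such programs have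
    finished. *)
Lemma incompressible_exists U : exists cx ch, forall c, exists x,
  1 <= x <= 2 ^ c /\
  (forall q, run U no_oracle q (str_of_nat x) -> c <= length q) /\
  eval (halting U) ch [c] x /\
  exists X : nat -> nat, (forall o t, eval o cx [c; t] (X t)) /\ exists t0, forall t, t0 <= t -> X t = x.
Proof.
  destruct (clocks_exist U 1) as (cu & cf & He & Hs & Hc).
  exists (cStage cu), (cOracleStage cu). intros c. set (m := pred (2 ^ c)).
  assert (Hcu : forall o t k, eval o cu [t; k] (cf t [k])) by (intros; now apply He).
  (* Excluded middle for each of the finitely many programs: a halting one is eventually constant, a
     diverging one stays at 0. *)
  assert (Hstab : exists t0, forall t k, t0 <= t -> k < m -> cf t [k] = cf t0 [k]).
  { generalize m. clear m. induction m as [|m (t1 & H1)]; [exists 0; intros; lia|].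
    destruct (excluded_middle_informative (exists v, eval no_oracle U [m] v)) as [(v & Hv)|N].
    - destruct (Hc [m] v eq_refl Hv) as (t2 & H2).
      exists (t1 + t2); intros t k Ht Hk. destruct (Nat.eq_dec k m) as [->|].
      + rewrite !H2 by lia. reflexivity.
      + rewrite (H1 t), (H1 (t1 + t2)) by lia. reflexivity.
    - exists t1; intros t k Ht Hk. destruct (Nat.eq_dec k m) as [->|]; [|apply H1; lia].
      assert (Hz : forall t, cf t [m] = 0).
      { intros s. destruct (cf s [m]) eqn:E; [reflexivity|]. destruct N; eauto. }
      now rewrite !Hz. }
  destruct Hstab as (t0 & Hstab). exists (S (unhit (fun k => cf t0 [k]) m)).
  destruct (unhit_spec (fun k => cf t0 [k]) m) as (Hle & Hz & _).
  split; [|split; [|split]].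
  - pose proof (Nat.pow_nonzero 2 c). unfold m in *; lia.
  (* A shorter program for [x] would already have the clocked value [x + 1] at stage [t0], which is
     a hit. *)
  - intros q Hq. destruct (le_lt_dec c (length q)) as [|Hlt]; [easy|exfalso].
    unfold run in Hq. rewrite str_of_natK in Hq.
    destruct (Hc [nat_of_str q] _ eq_refl Hq) as (t1 & H1).
    assert (Hqm : nat_of_str q < m).
    { destruct (nat_of_str_bounds q) as [_ Hu].
      pose proof (Nat.pow_le_mono_r 2 (S (length q)) c). unfold m; lia. }
    rewrite hits_zero in Hz. apply (Hz _ Hqm). rewrite <- (H1 (t0 + t1)) by lia.
    symmetry; apply Hstab; lia.
  (* The oracle computation stops at the first time [t] with nothing pending, possibly before [t0].
     Both stages agree: any value present is the true one, and at time [t] every halting program has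
     its value. *)
  - destruct (least_witness (fun t => pending (halting U) (fun k => cf t [k]) m = 0)
      (fun t => Nat.eq_dec _ _) t0) as (t & _ & Ht & Hlt).
    + apply pending_zero. intros k Hk Hhalt. apply halting_true in Hhalt. destruct Hhalt as (v & Hv).
      destruct (Hc [k] v eq_refl Hv) as (t1 & H1).
      rewrite <- (Hstab (t0 + t1)), H1 by lia. discriminate.
    + eapply eval_eq; [now apply eval_oracle_stage with (t := t)|]. f_equal. apply unhit_ext.
      intros k Hk. rewrite pending_zero in Ht. specialize (Ht k Hk). rewrite halting_true in Ht.
      destruct (cf t [k]) as [|v] eqn:E1.
      * destruct (cf t0 [k]) as [|v0] eqn:E0; [reflexivity|].
        destruct Ht; [exists v0; now apply (Hs t0)|reflexivity].
      * apply Hs in E1; [|reflexivity]. destruct (Hc [k] _ eq_refl E1) as (t1 & H1).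
        now rewrite <- (H1 (t0 + t1)), Hstab by lia.
  - exists (fun t => S (unhit (fun k => cf t [k]) m)). split; [intros; now apply eval_stage|].
    exists t0; intros t Ht. f_equal. apply unhit_ext. intros k Hk. now apply Hstab.
Qed.

(** * Computing the index of the pair *)

(** Fixes the first argument to [n]; the other two are the string and the stage supplied by
    [lc_enum] and [ssm_enum]. *)
Definition param (f : code) (n : nat) : code := CComp f [numeral n; CProj 0; CProj 1].

Fixpoint repeat_bits (s : str) (n : nat) : str :=
  match n with 0 => [] | S k => s ++ repeat_bits s k end.

(** The part of [enc] contributed by one [CComp CSucc [_]] of a numeral. *)
Definition digit : str := [true; false; false; false; false; true; true; false].

Lemma enc_numeral n : enc (numeral n) = repeat_bits digit n ++ [false; false; false].
Proof. induction n as [|n IH]; [reflexivity|]. simpl. now rewrite app_nil_r, IH. Qed.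

(** Only the middle block depends on [n], and it repeats one fixed word. The index is therefore
    computable from [n], and its complexity is logarithmic although its length is linear in [n]. *)
Lemma enc_param f n : enc (param f n) =
  ([true; false; false] ++ enc f ++ unary 3) ++ repeat_bits digit n ++
  ([false; false; false] ++ enc (CProj 0) ++ enc (CProj 1)).
Proof. cbn [param enc]. rewrite enc_numeral, app_nil_r, !app_assoc. reflexivity. Qed.

Fixpoint cBits (s : str) : code :=
  match s with
  | [] => CProj 0
  | b :: s => CComp (cBits s)
      [CComp cAdd [CComp cMul [numeral 2; CProj 0]; numeral (1 + if b then 1 else 0)]]
  end.
Lemma eval_bits o s a : eval o (cBits s) [a] (app_bits s a).
Proof.
  revert a; induction s as [|b s IH]; intros a; [apply (ev_proj o 0 [a])|]. cbn [cBits].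
  eapply ev_comp; [ev|]. eapply eval_eq; [apply IH|].
  unfold app_bits; cbn [fold_left nth]. f_equal. lia.
Qed.
#[local] Hint Resolve eval_bits : ev.

Definition cRepeat (s : str) : code := CRec (CProj 0) (CComp (cBits s) [CProj 1]).
Lemma eval_repeat o s n a : eval o (cRepeat s) [n; a] (app_bits (repeat_bits s n) a).
Proof.
  apply eval_rec with (F := fun n => app_bits (repeat_bits s n) a); [ev|].
  intros k. eapply eval_eq; [ev|]. cbn [nth].
  (* [cRepeat] appends the new copy last while [repeat_bits] puts it first; copies of the same word
     commute. *)
  assert (H : forall k a, app_bits s (app_bits (repeat_bits s k) a) = app_bits (repeat_bits s k) (app_bits s a)).
  { clear k a; induction k as [|k IH]; intros a; [reflexivity|].
    simpl. rewrite !app_bits_app. apply IH. }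
  simpl. now rewrite H, app_bits_app.
Qed.
#[local] Hint Resolve eval_repeat : ev.

Definition cParam (f : code) : code :=
  CComp (cBits ([false; false; false] ++ enc (CProj 0) ++ enc (CProj 1)))
    [CComp (cRepeat digit) [CProj 0; CComp (cBits ([true; false; false] ++ enc f ++ unary 3)) [CProj 1]]].
Lemma eval_param o f n a : eval o (cParam f) [n; a] (app_bits (enc (param f n)) a).
Proof.
  eapply eval_eq; [unfold cParam; ev|]. now rewrite enc_param, !app_bits_app.
Qed.
#[local] Hint Resolve eval_param : ev.

Definition cSqrt : code :=
  CMu (CComp cSub [CComp CSucc [CProj 1]; CComp cMul [CComp CSucc [CProj 0]; CComp CSucc [CProj 0]]]).

(** From [c <= n] the number lies strictly below the square of [n + 1], so its integer root is
    [n]. *)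
Lemma eval_sqrt o n c : c <= n -> eval o cSqrt [n * n + c] n.
Proof.
  intros H. apply eval_mu with (F := fun r => S (n * n + c) - S r * S r); [intros; ev|nia|intros; nia].
Qed.

(** A pair [c <= n] is presented as the single number [n * n + c]. *)
Definition cPairIndex (f g : code) : code :=
  CComp (cParam g) [cSqrt; CComp (cParam f) [CComp cSub [CProj 0; CComp cMul [cSqrt; cSqrt]]; CZero]].

Lemma eval_pair_index o f g n c : c <= n ->
  eval o (cPairIndex f g) [n * n + c] (nat_of_str (enc (param f c) ++ enc (param g n))).
Proof.
  intros H. pose proof (eval_sqrt o n c H) as Hs. rewrite nat_of_str_app.
  eapply eval_eq; [unfold cPairIndex; ev|]. cbn [nth].
  replace (n * n + c - n * n) with c by lia. reflexivity.
Qed.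

(** * The function and the measure *)

Definition merge (x : nat) (z : str) : str := if nat_of_str z =? x then [false] else z.

(** Stage [t] compares with the current approximation of [x]; [numeral 1] is the number of
    [[false]]. *)
Definition cMerge (cx : code) : code :=
  CComp cIf0 [CComp cDist [CProj 1; CComp cx [CProj 0; CProj 2]]; numeral 1; CProj 1].

Lemma eval_param_code o f n v t w : eval o f [n; v; t] w -> eval o (param f n) [v; t] w.
Proof. intros H. eapply ev_comp; [ev|exact H]. Qed.

(** Once the approximation has settled, the stage output is constant at every argument, so the limit
    exists everywhere. *)
Lemma limit_of_merge cx c (X : nat -> nat) x t0 :
  (forall o t, eval o cx [c; t] (X t)) -> (forall t, t0 <= t -> X t = x) ->
  total2 (param (cMerge cx) c) /\ limit_of (param (cMerge cx) c) (merge x).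
Proof.
  intros HX Hx.
  assert (He : forall v t, eval no_oracle (param (cMerge cx) c) [v; t]
                 (if v - X t + (X t - v) =? 0 then 1 else v)).
  { intros v t. apply eval_param_code. pose proof (HX no_oracle t).
    unfold cMerge. eapply ev_comp; [|ev]. constructor; [|ev]. eapply ev_comp; [|ev].
    constructor; [ev|]. constructor; [eapply ev_comp; [ev|eassumption]|constructor]. }
  assert (Hl : forall z, lim_out (param (cMerge cx) c) z (merge x z)).
  { intros z. exists t0; intros t Ht. eapply eval_eq; [apply He|]. rewrite Hx by exact Ht.
    unfold merge. destruct (Nat.eqb_spec (nat_of_str z) x) as [<-|N].
    - now rewrite Nat.sub_diag.
    - destruct (Nat.eqb_spec (nat_of_str z - x + (x - nat_of_str z)) 0); [lia|reflexivity]. }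
  split; [intros z t; eauto|]. intros z; split.
  - intros y [t1 H1]. destruct (Hl z) as [t2 H2]. apply nat_of_str_inj.
    eapply eval_det; [apply (H2 (t1 + t2)); lia|apply H1; lia].
  - intros N; destruct N; eauto.
Qed.

Definition flat (n v : nat) : R := if (1 <=? v) && (v <=? 2 ^ n) then (/ 2 ^ n)%R else 0%R.

Definition cFlat : code :=
  CComp cGuard [CProj 1; CComp cGuard [CComp cSub [CComp CSucc [CComp cPow2 [CProj 0]]; CProj 1];
    CComp cGuard [CComp cSub [CComp CSucc [CProj 2]; CProj 0]; CComp cPow2 [CComp cSub [CProj 2; CProj 0]]]]].

(** The numerator over [2 ^ t] of an approximation from below: 0 before stage [n], exact afterwards.
    The same code witnesses computability and lower semicomputability. *)
Definition flat_stage (n v t : nat) : nat :=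
  if (1 <=? v) && (v <=? 2 ^ n) && (n <=? t) then 2 ^ (t - n) else 0.

Lemma eval_flat o n v t : eval o (param cFlat n) [v; t] (flat_stage n v t).
Proof.
  apply eval_param_code. eapply eval_eq; [unfold cFlat; ev|]. unfold flat_stage. cbn [nth hd].
  destruct (Nat.leb_spec 1 v), (Nat.leb_spec v (2 ^ n)), (Nat.leb_spec n t);
    destruct (Nat.eqb_spec v 0), (Nat.eqb_spec (S (2 ^ n) - v) 0), (Nat.eqb_spec (S t - n) 0);
    simpl; try reflexivity; lia.
Qed.

Open Scope R_scope.

Lemma pow2_pos n : 0 < 2 ^ n.
Proof. apply pow_lt; lra. Qed.

Lemma flat_nonneg n v : 0 <= flat n v.
Proof. pose proof (Rinv_0_lt_compat _ (pow2_pos n)). unfold flat. destruct (_ && _)%bool; lra. Qed.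

Lemma flat_stage_spec n v t :
  INR (flat_stage n v t) / 2 ^ t = if (n <=? t)%nat then flat n v else 0.
Proof.
  unfold flat_stage, flat. destruct ((1 <=? v)%nat && (v <=? 2 ^ n)%nat)%bool, (Nat.leb_spec n t);
    simpl; unfold Rdiv; rewrite ?Rmult_0_l; auto.
  rewrite pow_INR. replace (INR 2) with 2 by (simpl; lra).
  replace t with (n + (t - n))%nat at 2 by lia. rewrite pow_add.
  pose proof (pow2_pos n); pose proof (pow2_pos (t - n)). field; lra.
Qed.

Lemma computable_flat n : computable_fun (fun z => flat n (nat_of_str z)).
Proof.
  exists (param cFlat n). intros z t. exists (flat_stage n (nat_of_str z) t).
  split; [apply eval_flat|]. rewrite flat_stage_spec.
  pose proof (Rinv_0_lt_compat _ (pow2_pos t)).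
  destruct (Nat.leb_spec n t).
  - rewrite Rminus_diag, Rabs_R0; lra.
  (* Before stage [n] the approximation is 0, and the error is at most [/ 2 ^ n], below the
     permitted [/ 2 ^ t]. *)
  - rewrite Rminus_0_l, Rabs_Ropp, Rabs_pos_eq by apply flat_nonneg.
    unfold flat. destruct (_ && _)%bool; [|lra].
    apply Rinv_le_contravar; [apply pow2_pos|]. apply Rle_pow; [lra|lia].
Qed.

Lemma lsc_flat n : lsc_by (param cFlat n) (fun z => flat n (nat_of_str z)).
Proof.
  split; [intros z t; eexists; apply eval_flat|]. intros z; split.
  - intros r (t & m & Hm & ->). rewrite (eval_det _ _ _ _ _ Hm (eval_flat _ _ _ _)), flat_stage_spec.
    destruct (n <=? t)%nat; [lra|apply flat_nonneg].
  - intros b Hb. apply Hb. exists n, (flat_stage n (nat_of_str z) n).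
    split; [apply eval_flat|]. now rewrite flat_stage_spec, Nat.leb_refl.
Qed.

(** * Sums over all strings *)

Definition total (g : nat -> R) (M : nat) : R := fold_right Rplus 0 (map g (seq 0 M)).

Lemma fold_Rplus_app l1 l2 :
  fold_right Rplus 0 (l1 ++ l2) = fold_right Rplus 0 l1 + fold_right Rplus 0 l2.
Proof. induction l1 as [|a l1 IH]; simpl; [|rewrite IH]; lra. Qed.

Lemma total_S g M : total g (S M) = total g M + g M.
Proof. unfold total. rewrite seq_S, map_app, fold_Rplus_app. simpl; lra. Qed.

(** The strings starting with 0 and with 1 fill two adjacent intervals, so each level is an interval
    of numbers. *)
Lemma map_app_bits_strings k : forall a,
  map (fun z => app_bits z a) (strings k) = seq ((a + 1) * 2 ^ k - 1) (2 ^ k).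
Proof.
  induction k as [|k IH]; intros a.
  - simpl. do 2 f_equal; lia.
  - cbn [strings]. rewrite map_app, !map_map.
    change (map (fun z => app_bits z (2 * a + 1 + 0)) (strings k) ++
            map (fun z => app_bits z (2 * a + 1 + 1)) (strings k) =
            seq ((a + 1) * 2 ^ S k - 1) (2 ^ S k)).
    rewrite !IH, Nat.pow_succ_r'. replace (2 * 2 ^ k)%nat with (2 ^ k + 2 ^ k)%nat by lia.
    rewrite seq_app. pose proof (Nat.pow_nonzero 2 k). f_equal; f_equal; nia.
Qed.

Lemma level_sum_nat g k :
  level_sum k (fun z => g (nat_of_str z)) = total g (2 ^ S k - 1) - total g (2 ^ k - 1).
Proof.
  unfold level_sum, total. rewrite <- (map_map nat_of_str g).
  change (map nat_of_str (strings k)) with (map (fun z => app_bits z 0) (strings k)).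
  rewrite map_app_bits_strings. pose proof (Nat.pow_nonzero 2 k).
  replace (2 ^ S k - 1)%nat with (2 ^ k - 1 + 2 ^ k)%nat by (simpl; lia).
  rewrite seq_app, map_app, fold_Rplus_app.
  replace (0 + (2 ^ k - 1))%nat with ((0 + 1) * 2 ^ k - 1)%nat by lia. lra.
Qed.

(** The level sums telescope. The start [j] is 1 for measures, which omit the empty string, and 0
    for the image. *)
Lemma sum_levels g j N :
  sum_n (fun k => level_sum (j + k) (fun z => g (nat_of_str z))) N =
  total g (2 ^ S (j + N) - 1) - total g (2 ^ j - 1).
Proof.
  induction N as [|N IH].
  - rewrite sum_O, level_sum_nat. now rewrite Nat.add_0_r.
  - rewrite sum_Sn, IH, level_sum_nat. unfold plus; simpl plus. rewrite Nat.add_succ_r. simpl; lra.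
Qed.

Lemma is_series_eventually (a : nat -> R) (l : R) N0 :
  (forall N, (N0 <= N)%nat -> sum_n a N = l) -> is_series a l.
Proof.
  intros H. change (is_lim_seq (sum_n a) l).
  apply is_lim_seq_ext_loc with (fun _ => l); [|apply is_lim_seq_const].
  exists N0; intros N HN; symmetry; auto.
Qed.

Lemma pow2_gt n : (n < 2 ^ n)%nat.
Proof. apply Nat.pow_gt_lin_r; lia. Qed.

Lemma total_flat n M : total (flat n) (S M) = INR (Nat.min M (2 ^ n)) / 2 ^ n.
Proof.
  pose proof (pow2_pos n).
  induction M as [|M IH].
  - unfold total, flat; simpl. lra.
  - rewrite total_S, IH. unfold flat.
    destruct (Nat.leb_spec 1 (S M)), (Nat.leb_spec (S M) (2 ^ n)); simpl andb; cbv iota; try lia.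
    + rewrite !Nat.min_l by lia. rewrite S_INR. field; lra.
    + rewrite !Nat.min_r by lia. lra.
Qed.

Lemma sum_flat n N :
  sum_n (fun k => level_sum (S k) (fun z => flat n (nat_of_str z))) N =
  INR (Nat.min (2 ^ (N + 2) - 2) (2 ^ n)) / 2 ^ n.
Proof.
  etransitivity; [exact (sum_levels (flat n) 1 N)|].
  replace (2 ^ S (1 + N) - 1)%nat with (S (2 ^ (N + 2) - 2)).
  2:{ replace (S (1 + N)) with (N + 2)%nat by lia. rewrite Nat.pow_add_r.
      pose proof (Nat.pow_nonzero 2 N). simpl (2 ^ 2)%nat. lia. }
  rewrite total_flat. unfold total at 1, flat. simpl. lra.
Qed.

Lemma INR_pow2 n : INR (2 ^ n) = 2 ^ n.
Proof. rewrite pow_INR. f_equal. Qed.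

Lemma measure_flat n : measure (fun z => flat n (nat_of_str z)).
Proof.
  split; [intros; apply flat_nonneg|]. apply is_series_eventually with n. intros N HN.
  rewrite sum_flat, Nat.min_r, INR_pow2.
  - apply Rdiv_diag, Rgt_not_eq, pow2_pos.
  - pose proof (Nat.pow_le_mono_r 2 n N). rewrite Nat.pow_add_r.
    pose proof (Nat.pow_nonzero 2 n). simpl (2 ^ 2)%nat. lia.
Qed.

Lemma semimeasure_flat n : semimeasure (fun z => flat n (nat_of_str z)).
Proof.
  split; [intros; apply flat_nonneg|]. intros N. rewrite sum_flat.
  pose proof (pow2_pos n). apply Rle_div_l; [lra|]. rewrite Rmult_1_l, <- INR_pow2.
  apply le_INR; lia.
Qed.

Lemma total_delta (x : nat) (r : R) M :
  total (fun v => if (v =? x)%nat then r else 0) M = if (x <? M)%nat then r else 0.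
Proof.
  induction M as [|M IH]; [reflexivity|]. rewrite total_S, IH.
  destruct (Nat.ltb_spec x M), (Nat.ltb_spec x (S M)), (Nat.eqb_spec M x); try lia; lra.
Qed.

Lemma total_plus g h M : total (fun v => g v + h v) M = total g M + total h M.
Proof. induction M as [|M IH]; [unfold total; simpl; lra|]. rewrite !total_S, IH; lra. Qed.

(** The preimages of [[false]] are [[false]] and the string numbered [x], each of mass [/ 2 ^ n];
    for [x = 1] they coincide, and the mass is counted once. *)
Lemma image_flat n x : (1 <= x <= 2 ^ n)%nat ->
  image (merge x) (fun z => flat n (nat_of_str z)) [false] =
  2 ^ (if (x =? 1)%nat then 0 else 1) / 2 ^ n.
Proof.
  intros Hx. apply is_series_unique, is_series_eventually with x. intros N HN.
  pose (g := fun v : nat => (if (v =? x)%nat then / 2 ^ n else 0) +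
                      (if (v =? 1)%nat then (if (x =? 1)%nat then 0 else / 2 ^ n) else 0)).
  transitivity (sum_n (fun k => level_sum (0 + k) (fun z => g (nat_of_str z))) N).
  - apply sum_n_ext; intros k. unfold level_sum. f_equal. apply map_ext. intros z.
    unfold merge, g, flat. pose proof (Nat.pow_nonzero 2 n).
    destruct (Nat.eqb_spec (nat_of_str z) x) as [->|N0].
    + destruct (list_eq_dec bool_dec [false] [false]) as [_|Nf]; [|easy].
      destruct (Nat.leb_spec 1 x), (Nat.leb_spec x (2 ^ n)), (Nat.eqb_spec x 1); simpl; lra || lia.
    + destruct (list_eq_dec bool_dec z [false]) as [->|N1].
      * change (nat_of_str [false]) with 1%nat in *. rewrite Nat.eqb_refl, Nat.leb_refl.
        destruct (Nat.eqb_spec x 1); [lia|]. destruct (Nat.leb_spec 1 (2 ^ n)); simpl; [lra|lia].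
      * destruct (Nat.eqb_spec (nat_of_str z) 1) as [E|_]; [|lra].
        destruct N1. now apply nat_of_str_inj.
  - rewrite sum_levels. unfold g. rewrite !total_plus, !total_delta.
    pose proof (pow2_gt (S (0 + N))). pose proof (pow2_pos n).
    assert (2 <= 2 ^ S (0 + N) - 1 \/ x = 1)%nat by lia.
    destruct (Nat.ltb_spec x (2 ^ S (0 + N) - 1)); [|lia].
    destruct (Nat.ltb_spec 1 (2 ^ S (0 + N) - 1)); [|lia]. simpl.
    destruct (x =? 1)%nat; simpl; field; lra.
Qed.

(** * Deficiency and logarithms *)

Lemma ln2_pos : 0 < ln 2.
Proof. pose proof ln_lt_2; lra. Qed.

Lemma log2_pow2 n : log2 (2 ^ n) = INR n.
Proof. unfold log2. rewrite ln_pow by lra. pose proof ln2_pos. field; lra. Qed.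

Lemma log2_le y z : 0 < y -> y <= z -> log2 y <= log2 z.
Proof.
  intros Hy Hz. unfold log2. apply Rmult_le_compat_r.
  - left; apply Rinv_0_lt_compat, ln2_pos.
  - now apply ln_le.
Qed.

Lemma log2_floor n : (0 < n)%nat -> INR (Nat.log2 n) <= log2 (INR n).
Proof.
  intros H. rewrite <- log2_pow2, <- INR_pow2. apply log2_le.
  - rewrite INR_pow2. apply pow2_pos.
  - apply le_INR. now apply Nat.log2_spec.
Qed.

Lemma deficiency_pow2 U p x j n : x <> [] -> p x = 2 ^ j / 2 ^ n ->
  deficiency U p x = Finite (INR n - INR j - INR (K U x)).
Proof.
  intros Hx Hp. unfold deficiency. destruct x as [|b x]; [easy|].
  pose proof (pow2_pos j); pose proof (pow2_pos n).
  assert (Hpos : 0 < p (b :: x)) by (rewrite Hp; now apply Rdiv_lt_0_compat).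
  destruct (Rlt_dec 0 (p (b :: x))); [|easy]. do 2 f_equal.
  assert (Hlog : log2 (p (b :: x)) = INR j - INR n).
  { rewrite <- !log2_pow2, Hp. unfold log2. rewrite ln_div by assumption.
    pose proof ln2_pos. field; lra. }
  (* The logarithm is an integer [L], and [up] is strictly above its argument, so [up L] is [L + 1]
     and the ceiling is exactly [- L]. *)
  rewrite Hlog, <- (tech_up _ (Z.of_nat j - Z.of_nat n + 1)).
  all: repeat rewrite ?minus_IZR, ?plus_IZR, <- ?INR_IZR_INZ; lra.
Qed.

Lemma length_unary n : length (unary n) = S n.
Proof. induction n; simpl; auto. Qed.

Lemma length_self_delim d n : length (self_delim d n) = (length (d (blen n)) + blen n)%nat.
Proof. apply length_app. Qed.

(** * The choice of the constant and the final estimates *)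

Theorem theorem2 (U : code) (hU : universal_pf U) :
  exists C : R, forall b c : nat, (2 <= b)%nat -> (2 <= c)%nat ->
    exists (B : str -> str) (p : str -> R) (x : str),
      let eps := C * log2 (INR (b * c)) in
      limit_computable B /\ computable_measure p /\
      KBp_le U B p eps /\
      Rbar_le (Rbar_abs (Rbar_minus (deficiency U (image B p) (B x)) (Finite (INR (b + c)))))
              (Finite eps) /\
      Rbar_le (Rbar_abs (Rbar_minus (deficiency U p x) (Finite (INR b)))) (Finite eps) /\
      Rabs (info_halting U x - INR c) <= eps.
Proof.
  destruct (incompressible_exists U) as (cx & ch & Hx).
  (* The nested code [Hdd] is for [x], where the leading term must be [c] with factor 1. For [c] and
     [n * n + c], themselves only of logarithmic length, a doubled length is harmless, so [Hd]
     suffices. *)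
  pose proof (codewords_self_delim _ _ codewords_unary) as Hd.
  pose proof (codewords_self_delim _ _ Hd) as Hdd.
  destruct (Kc_machine U _ _ (CProj 0) hU Hdd) as (k1 & Hk1).
  destruct (Kc_machine U _ _ ch hU Hd) as (k2 & Hk2).
  destruct (Kc_machine U _ _ (cPairIndex (cMerge cx) cFlat) hU Hd) as (k3 & Hk3).
  (* The 6 covers the additive constants; the largest is 5, since the codeword of [n * n + c] has
     length at most [4 * l + 5]. *)
  set (k0 := K U [false]). pose (k := (6 + k0 + k1 + k2 + k3)%nat).
  exists (4 + INR k). intros b c Hb Hc.
  destruct (Hx c) as (x & Hxb & Hxlow & Hxh & X & HX & t0 & Ht0).
  set (l := Nat.log2 (b * c)). set (n := (b + c)%nat).
  assert (Hl : (b * c < 2 ^ S l)%nat) by (apply Nat.log2_spec; nia).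
  (* Both factors are at least 2, so their sum is at most their product and [l] also controls the
     logarithm of [n]. *)
  assert (Hn : (n <= b * c)%nat) by (unfold n; nia).
  (* Since [l] is at least 1, the additive constant [k] is absorbed into the multiple of the
     logarithm. *)
  assert (Heps : forall r, r <= 4 * INR l + INR k -> r <= (4 + INR k) * log2 (INR (b * c))).
  { intros r Hr. pose proof (log2_floor (b * c) ltac:(nia)) as Hlog. fold l in Hlog.
    assert (1 <= INR l).
    { apply (le_INR 1). apply (Nat.log2_le_mono 2 (b * c)). nia. }
    pose proof (pos_INR k). nra. }
  assert (Hblen : forall m, (m <= c)%nat -> (blen m <= l)%nat).
  { intros m Hm. eapply Nat.le_trans; [apply blen_log2|]. apply Nat.log2_le_mono. nia. }
  assert (Hlenx : (blen x <= c)%nat).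
  { apply blen_le. rewrite Nat.pow_succ_r'. pose proof (pow2_gt c). lia. }
  destruct (Hk1 no_oracle x (str_of_nat x)) as [[q Hq] HKx].
  { rewrite str_of_natK. ev. }
  change (Kc U no_oracle) with (K U) in HKx.
  assert (HKlow : (c <= K U (str_of_nat x))%nat).
  { destruct (Kc_spec _ _ _ _ Hq) as [(q' & Hq' & E) _]. unfold K. rewrite <- E. now apply Hxlow. }
  destruct (Hk2 (halting U) c (str_of_nat x)) as [_ HKHx].
  { now rewrite str_of_natK. }
  change (Kc U (halting U)) with (KH U) in HKHx.
  destruct (Hk3 no_oracle (n * n + c)%nat (enc (param (cMerge cx) c) ++ enc (param cFlat n))) as [_ HKi].
  { apply eval_pair_index. unfold n; lia. }
  change (Kc U no_oracle) with (K U) in HKi.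
  rewrite length_self_delim in HKx, HKHx, HKi. rewrite length_self_delim in HKx.
  rewrite length_unary in HKx, HKHx, HKi.
  pose proof (Hblen (blen x) Hlenx). pose proof (Hblen c ltac:(lia)).
  assert (blen (n * n + c) <= S (S (2 * l)))%nat.
  { apply blen_le. replace (S (S (S (2 * l)))) with (S l + S l + 1)%nat by lia.
    rewrite (Nat.pow_add_r 2 (S l + S l)), (Nat.pow_add_r 2 (S l) (S l)). assert (c <= n)%nat by (unfold n; lia).
    assert (S n * S n <= 2 ^ S l * 2 ^ S l)%nat by (apply Nat.mul_le_mono; lia).
    clearbody n. generalize dependent (2 ^ S l)%nat. intros P. simpl (2 ^ 1)%nat. pose proof (Nat.le_0_l (n * n)). lia. }
  assert (Hxn : (1 <= x <= 2 ^ n)%nat).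
  { pose proof (Nat.pow_le_mono_r 2 c n). unfold n in *; lia. }
  destruct (limit_of_merge cx c X x t0 HX Ht0) as (Htot & Hlim).
  assert (Hxnil : str_of_nat x <> []).
  { intros E. assert (nat_of_str (str_of_nat x) = 0)%nat by now rewrite E.
    rewrite str_of_natK in *; lia. }
  assert (HKi' : (K U (enc (param (cMerge cx) c) ++ enc (param cFlat n)) <= 4 * l + k)%nat) by (unfold k; lia).
  assert (HKx' : (K U (str_of_nat x) <= c + (4 * l + k))%nat) by (unfold k; lia).
  assert (HKHx' : (KH U (str_of_nat x) <= 4 * l + k)%nat) by (unfold k; lia).
  assert (Hk0 : (1 + k0 <= k)%nat) by (unfold k; lia).
  clearbody k. apply le_INR in HKlow, HKi', HKx', HKHx', Hk0.
  assert (Hlk : INR (4 * l + k) = 4 * INR l + INR k) by (rewrite plus_INR, mult_INR; simpl (INR 4); lra).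
  rewrite plus_INR in HKx', Hk0. simpl (INR 1) in Hk0.
  pose proof (pos_INR k0). pose proof (pos_INR l). pose proof (pos_INR (KH U (str_of_nat x))).
  exists (merge x), (fun z => flat n (nat_of_str z)), (str_of_nat x). cbv zeta.
  split; [now exists (param (cMerge cx) c)|].
  split; [split; [apply measure_flat|apply computable_flat]|].
  split; [|split; [|split]].
  - exists (param (cMerge cx) c), (param cFlat n). split; [now left|].
    split; [left; split; [apply lsc_flat|apply semimeasure_flat]|].
    apply Heps. lra.
  - assert (merge x (str_of_nat x) = [false]) as ->.
    { unfold merge. now rewrite str_of_natK, Nat.eqb_refl. }
    erewrite deficiency_pow2; [|discriminate|exact (image_flat n x Hxn)]. fold k0.
    (* The deficiency is [n - k0], less one more when the two merged strings differ. *)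
    simpl. apply Heps. apply Rabs_le. fold n. destruct (x =? 1)%nat; simpl; lra.
  - erewrite (deficiency_pow2 _ _ _ 0 n); [|exact Hxnil|].
    + simpl. apply Heps. apply Rabs_le. unfold n. rewrite plus_INR. lra.
    + rewrite str_of_natK. unfold flat. rewrite (proj2 (Nat.leb_le 1 x)), (proj2 (Nat.leb_le x _)) by lia.
      simpl; unfold Rdiv; ring.
  - apply Heps. unfold info_halting. apply Rabs_le. lra.
Qed.
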